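(* Let $(E_i)_{i\ge1}$ be subsets of $\mathbb{N}$ such that $E=\bigcup_{i\ge1}E_i$ is minimal, let $(A_i)_{i\ge1}$ be infinite pairwise coprime subsets of $\mathbb{N}$ (that is, for each $i$ the set $A_i$ is infinite and any two distinct elements of $A_i$ are coprime), and let $B=\bigcup_{i\ge1}E_iA_i$. Then $B^*=E$.
   Context: $\mathbb{N}=\{1,2,\dots\}$. For $X,Y\subseteq\mathbb{N}$ and $d\in\mathbb{N}$, $XY=\{xy:x\in X,y\in Y\}$ and $dX=\{dx:x\in X\}$. For $B\subseteq\mathbb{N}$ let $\mathcal{M}_B=\bigcup_{b\in B}b\mathbb{Z}$ and $\mathcal{F}_B=\mathbb{Z}\setminus\mathcal{M}_B$. $B$ is primitive if $b\mid b'$ with $b,b'\in B$ implies $b=b'$; $B^{prim}=B\setminus\bigcup_{k\ge2}kB$. $B$ is minimal if it is primitive and for every $n\in\mathbb{Z}$ there is $s_n\in\mathbb{N}$ such that either $n+s_n\mathbb{Z}\subseteq\mathcal{M}_B$ or $n+s_n\mathbb{Z}\subseteq\mathcal{F}_B$ (i.e. $\mathbf{1}_{\mathcal{F}_B}$ is a Toeplitz sequence). Put $D(B)=\{d\in\mathbb{N}: dA\subseteq B\text{ for some infinite pairwise coprime set }A\subseteq\mathbb{N}\}$ and define $B^*=(B\cup D(B))^{prim}$. *)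

(* Defs.v *)
From mathcomp Require Import all_boot all_order all_algebra.
From mathcomp Require Import mathcomp_extra boolp classical_sets cardinality.

Set Implicit Arguments.
Unset Strict Implicit.
Unset Printing Implicit Defensive.

Import Order.TTheory GRing.Theory Num.Theory.

Local Open Scope classical_set_scope.
Local Open Scope nat_scope.

(* The positive integers {1, 2, ...}; subsets of them are represented as sets
   X : set nat with X `<=` posnat. *)
Definition posnat : set nat := [set n | 0 < n].

Definition prodset (X Y : set nat) : set nat :=
  [set x * y | x in X & y in Y].

Definition dilate (d : nat) (X : set nat) : set nat :=
  [set d * x | x in X].

Definition multiples (B : set nat) : set int :=
  \bigcup_(b in B) [set (b%:Z * k)%R | k in [set: int]].

Definition free_numbers (B : set nat) : set int := ~` multiples B.

Definition primitive (B : set nat) : Prop :=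
  forall b b', B b -> B b' -> b %| b' -> b = b'.

Definition prim (B : set nat) : set nat :=
  B `\` \bigcup_(k in [set k | 2 <= k]) dilate k B.

Definition progression (n : int) (s : nat) : set int :=
  [set (n + s%:Z * k)%R | k in [set: int]].

Definition minimal (B : set nat) : Prop :=
  primitive B /\
  forall n : int, exists s : nat, 0 < s /\
    (progression n s `<=` multiples B \/ progression n s `<=` free_numbers B).

(* Only distinct elements are compared, so 1 may belong to A. *)
Definition pairwise_coprime (A : set nat) : Prop :=
  forall a a', A a -> A a' -> a <> a' -> coprime a a'.

Definition Dset (B : set nat) : set nat :=
  [set d | 0 < d /\
    exists A : set nat, [/\ A `<=` posnat, infinite_set A,
      pairwise_coprime A & dilate d A `<=` B]].

Definition star (B : set nat) : set nat := prim (B `|` Dset B).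

(* Main.v *)
(** Write E for the union of the E_i and put M = multiples E. The inclusion
    B `<=` M is clear, and E `<=` Dset B. If d is in Dset B but not in M,
    minimality gives s with d + sZ disjoint from M; an infinite pairwise
    coprime set has an element a coprime to s, and d * a in M forces d * a ^
    totient s in M, although it is congruent to d modulo s. Hence E `<=` B
    `|` Dset B `<=` M, and as E is primitive it is the set of primitive
    elements of B `|` Dset B. *)
Require Import Defs.
From mathcomp Require Import all_boot all_order all_algebra.
From mathcomp Require Import mathcomp_extra boolp classical_sets cardinality.
From mathcomp Require Import cyclic.

Set Implicit Arguments.
Unset Strict Implicit.
Unset Printing Implicit Defensive.

Local Open Scope classical_set_scope.
Local Open Scope nat_scope.

(** Otherwise each [a] in [A] shares a prime with [s]. The least such prime [f a] is at most [s]
    and, by pairwise coprimality, determines [a], so [A] would be finite. *)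
Lemma exists_coprime_of_pairwise_coprime (A : set nat) (s : nat) :
  0 < s -> infinite_set A -> pairwise_coprime A ->
  exists2 a, A a & coprime a s.
Proof.
move=> s_gt0 Ainf Acop; apply: contrapT => no_a; apply: Ainf.
pose f a := pdiv (gcdn a s).
have gcd_gt1 a : A a -> 1 < gcdn a s.
  move=> Aa; rewrite ltn_neqAle eq_sym gcdn_gt0 s_gt0 orbT andbT.
  by apply/negP => cop; apply: no_a; exists a.
have f_inj : {in A &, injective f}.
  move=> a b /set_mem Aa /set_mem Ab fab; apply: contrapT => /(Acop _ _ Aa Ab).
  have f_dvd c : f c %| c := dvdn_trans (pdiv_dvd _) (dvdn_gcdl c s).
  have : f a %| gcdn a b by rewrite dvdn_gcd f_dvd fab f_dvd.
  move=> /[swap] /eqP ->; rewrite dvdn1 => /eqP fa1.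
  by have := pdiv_prime (gcd_gt1 a Aa); rewrite -/(f a) fa1.
have fA_fin : finite_set (f @` A).
  apply: (sub_finite_set _ (finite_II s.+1)) => _ [a Aa <-] /=.
  rewrite ltnS; apply: dvdn_leq => //.
  exact: dvdn_trans (pdiv_dvd _) (dvdn_gcdr a s).
by rewrite -(eq_finite_set (inj_card_eq f_inj)).
Qed.

Lemma multiples_natP (E : set nat) (n : nat) :
  multiples E (Posz n) <-> exists2 e, E e & e %| n.
Proof.
split=> [[e Ee [k _ ekn]]|[e Ee /dvdnP[k ->]]]; exists e => //.
  have: (Posz e %| Posz n)%Z by rewrite -ekn dvdz_mulr.
  by rewrite dvdzE.
by exists (Posz k) => //; rewrite mulnC PoszM.
Qed.

Lemma multiples_of_dilate (E A : set nat) (d : nat) :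
  minimal E -> infinite_set A -> pairwise_coprime A ->
  (forall a, A a -> multiples E (Posz (d * a))) -> multiples E (Posz d).
Proof.
move=> [_ /(_ (Posz d)) [s [s_gt0 toeplitz]]] Ainf Acop dA.
apply: contrapT => Nd.
have [a Aa a_s] := exists_coprime_of_pairwise_coprime s_gt0 Ainf Acop.
(* The progression contains [d] itself, which rules out the other alternative. *)
have free : progression d s `<=` free_numbers E.
  case: toeplitz => // sub; case: Nd; apply: sub.
  by exists 0%R => //; rewrite GRing.mulr0 GRing.addr0.
have /multiples_natP[e Ee e_da] := dA a Aa.
(* Euler's theorem puts this number in the progression. The exponent is positive, so [d * a] divides
   it. *)
have := free (Posz (d * a ^ totient s)); apply.
  have: (Posz s %| (Posz (d * a ^ totient s) - Posz d)%R)%Z.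
    rewrite -eqz_mod_dvd; apply/eqP; rewrite !modz_nat; congr Posz.
    by rewrite -modnMmr Euler_exp_totient // modnMmr muln1.
  move=> /dvdzP[k kE]; exists k => //.
  by rewrite GRing.mulrC -kE GRing.addrC GRing.subrK.
apply/multiples_natP; exists e => //.
apply: dvdn_trans e_da _; rewrite dvdn_mul //.
by rewrite dvdn_exp // totient_gt0.
Qed.

(** An [x] in [X] is [k * e] with [e] in [E], and survives only if [k = 1]; positivity excludes
    [k = 0]. Conversely, if [e = k * x] with [k >= 2], some [e'] in [E] divides [x], hence [e];
    primitivity gives [e' = e], so [e <= x < e]. *)
Lemma prim_eq (E X : set nat) :
  X `<=` posnat -> primitive E -> E `<=` X ->
  (forall x, X x -> exists2 e, E e & e %| x) -> prim X = E.
Proof.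
move=> Xpos Eprim EX XE; apply/seteqP; split=> [x [Xx Nx]|e Ee].
  have [e Ee /dvdnP[k xE]] := XE x Xx.
  move: (Xpos _ Xx); rewrite /posnat /= xE muln_gt0 => /andP[k_gt0 _].
  have [k_gt1|k_le1] := ltnP 1 k.
    by case: Nx; exists k => //; exists e => //; exact: EX.
  by have -> : k = 1 by [apply/eqP; rewrite eqn_leq k_le1]; rewrite mul1n.
split; first exact: EX.
move=> [k /= k_gt1 [x Xx kxe]]; have [e' Ee' e'x] := XE x Xx.
have e'e : e' = e.
  by apply: Eprim => //; rewrite -kxe dvdn_mull.
have x_gt0 := Xpos _ Xx.
have := dvdn_leq x_gt0 e'x.
by rewrite e'e -kxe leqNgt ltn_Pmull.
Qed.

Theorem theorem1p10 (E A : nat -> set nat)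
  (hE : forall i, 1 <= i -> E i `<=` posnat)
  (hmin : minimal (\bigcup_(i >= 1) E i))
  (hA : forall i, 1 <= i -> A i `<=` posnat)
  (hAinf : forall i, 1 <= i -> infinite_set (A i))
  (hAcop : forall i, 1 <= i -> pairwise_coprime (A i)) :
  star (\bigcup_(i >= 1) prodset (E i) (A i)) =
  \bigcup_(i >= 1) E i.
Proof.
set F := \bigcup_(i >= 1) E i; set B := \bigcup_(i >= 1) _.
have B_mul x : B x -> exists2 e, F e & e %| x.
  by move=> [i i1 [e Ee [a Aa <-]]]; exists e; [exists i | exact: dvdn_mulr].
apply: prim_eq.
- move=> x [[i i1 [e Ee [a Aa <-]]]|[]//].
  by rewrite /posnat /= muln_gt0 (hE _ i1 _ Ee) (hA _ i1 _ Aa).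
- by case: hmin.
(* For [e] in [E i], the set [A i] itself witnesses membership in [Dset B]. *)
- move=> e [i i1 Ee]; right; split; first exact: hE Ee.
  exists (A i); split; [exact: hA|exact: hAinf|exact: hAcop|].
  by move=> _ [a Aa <-]; exists i => //; exists e => //; exists a.
- move=> x [/B_mul//|[_ [A' [_ A'inf A'cop dA']]]]; apply/multiples_natP.
  apply: multiples_of_dilate hmin A'inf A'cop _ => a A'a.
  by apply/multiples_natP/B_mul/dA'; exists a.
Qed.
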